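(* Let $\Gamma$ be a sequent of a language $\mathcal L$. If $\Gamma$ is i-valid then $\Gamma$ is provable. Hence, for all sets $\Pi,\Sigma$ of sentences of $\mathcal L$, $\Pi\models_i\Sigma$ implies $\Pi\vdash\Sigma$.
   Context: **Syntax.** Fix a finite set $\mathcal B$ of basic types. The set $\mathcal T$ of types is the smallest set of strings with $\mathcal B\subseteq\mathcal T$ and $\langle\alpha_1\ldots\alpha_n\rangle\in\mathcal T$ whenever $\alpha_1,\ldots,\alpha_n\in\mathcal T$ ($n\ge 0$). Types $\langle\alpha_1\ldots\alpha_n\rangle$ (including $\langle\rangle$) are called complex. A language is a countable set $\mathcal L$ of uniquely typed (non-logical) constants; $\mathcal L_\alpha$ is the set of its constants of type $\alpha$. For each type $\alpha$ there is a denumerably infinite set $\mathcal V_\alpha$ of variables with unique type $\alpha$; $\mathcal V=\bigcup_\alpha\mathcal V_\alpha$. The sets $T^{\mathcal L}_\alpha$ of terms of $\mathcal L$ of type $\alpha$ are given inductively: $\mathcal L_\alpha,\mathcal V_\alpha\subseteq T^{\mathcal L}_\alpha$; $\bot\in T^{\mathcal L}_{\langle\rangle}$; if $A\in T^{\mathcal L}_{\langle\alpha_1\alpha_2\ldots\alpha_n\rangle}$ and $B\in T^{\mathcal L}_{\alpha_1}$ then $(AB)\in T^{\mathcal L}_{\langle\alpha_2\ldots\alpha_n\rangle}$; if $A\in T^{\mathcal L}_{\langle\alpha_2\ldots\alpha_n\rangle}$ and $x\in\mathcal V_{\alpha_1}$ then $(\lambda x.A)\in T^{\mathcal L}_{\langle\alpha_1\alpha_2\ldots\alpha_n\rangle}$;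 if $A,B\in T^{\mathcal L}_\alpha$ with $\alpha$ complex then $(A\subset B)\in T^{\mathcal L}_{\langle\rangle}$. $T^{\mathcal L}=\bigcup_\alpha T^{\mathcal L}_\alpha$. Terms of type $\langle\rangle$ are formulas; closed formulas are sentences. Application associates to the left. $A\{x:=B\}$ is substitution of $B$ for the free occurrences of $x$ in $A$; ''$B$ is free for $x$ in $A$'' has its usual meaning (no variable capture). Terms are not identified up to $\alpha$-conversion. **Intensional models.** A collection of domains is a family $D=\{D_\alpha\mid\alpha\in\mathcal T\}$ of pairwise disjoint non-empty sets. An assignment for $D$ is a function $a$ on $\mathcal V$ with $a(x)\in D_\alpha$ for $x\in\mathcal V_\alpha$; $\mathcal A_D$ is the set of assignments; $a[d/x]$ is $a$ changed to send $x$ to $d$. An intension function for $D$ and $\mathcal L$ is a function $I$ from $\mathcal A_D\times T^{\mathcal L}$ to $\bigcup_\alpha D_\alpha$ such that: (1) $I(a,A)\in D_\alpha$ if $A$ has type $\alpha$; (2) $I(a,x)=a(x)$ for variables $x$; (3) $I(a,A)=I(a',A)$ if $a,a'$ agree on all variables free in $A$; (4) $I(a,A\{x:=B\})=I(a[I(a,B)/x],A)$ if $B$ is free for $x$ in $A$. An extension function for $D$ is a function $E$ with domain $\bigcup\{D_\alpha\mid\alpha\text{ complex}\}$ such that $E(d)\subseteq D_{\alpha_1}\times\cdots\times D_{\alpha_n}$ whenever $d\in D_{\langle\alpha_1\ldots\alpha_n\rangle}$. For $n=0$ the product is $\{\langle\rangle\}$; write $0=\varnothing$ and $1=\{\langle\rangle\}$,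 so $E$ maps $D_{\langle\rangle}$ to $\{0,1\}$. Put $V(a,A)=E(I(a,A))$ for $A$ of complex type. A triple $M=\langle D,I,E\rangle$ of such objects is an intensional model for $\mathcal L$ if for all $a$ and all terms of $\mathcal L$ of appropriate types: (1) $V(a,\bot)=0$; (2) $V(a,AB)=\{\langle\vec d\rangle\mid\langle I(a,B),\vec d\rangle\in V(a,A)\}$; (3) $V(a,\lambda x_\beta.A)=\{\langle d,\vec d\rangle\mid d\in D_\beta\text{ and }\langle\vec d\rangle\in V(a[d/x],A)\}$; (4) $V(a,A\subset B)=1$ iff $V(a,A)\subseteq V(a,B)$. For a sentence $\varphi$, $M\models\varphi$ means $V(a,\varphi)=1$ for some (equivalently, any) assignment $a$. **Sequents.** A sequent of $\mathcal L$ is a (finite or infinite) set of signed sentences $\mathsf L\colon\varphi$ or $\mathsf R\colon\varphi$ with $\varphi$ a sentence of $\mathcal L$. For sets $\Pi,\Sigma$ of sentences, $\Pi\Rightarrow\Sigma$ denotes $\{\mathsf L\colon\varphi\mid\varphi\in\Pi\}\cup\{\mathsf R\colon\varphi\mid\varphi\in\Sigma\}$; $\Pi,\varphi$ means $\Pi\cup\{\varphi\}$. An intensional model $M$ for $\mathcal L$ refutes $\Pi\Rightarrow\Sigma$ if $M\models\varphi$ for all $\varphi\in\Pi$ and $M\not\models\varphi$ for all $\varphi\in\Sigma$. A sequent of $\mathcal L$ is i-valid if no intensional model for $\mathcal L$ refutes it. $\Pi\models_i\Sigma$ means that $\Pi\Rightarrow\Sigma$ is i-valid. **Sequent rules** (premises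 / conclusion; all formulas displayed are sentences, $\vec C$ is a sequence of closed terms of appropriate types, possibly empty): - $[W]$: $\Pi\Rightarrow\Sigma\ /\ \Pi'\Rightarrow\Sigma'$, if $\Pi\subseteq\Pi'$ and $\Sigma\subseteq\Sigma'$. - $[R]$: (no premise) $/\ \Pi,\varphi\Rightarrow\Sigma,\varphi$. - $[\bot\mathsf L]$: (no premise) $/\ \Pi,\bot\Rightarrow\Sigma$. - $[\lambda\mathsf L]$: $\Pi,A\{x:=B\}\vec C\Rightarrow\Sigma\ /\ \Pi,(\lambda x.A)B\vec C\Rightarrow\Sigma$, if $B$ is free for $x$ in $A$. - $[\lambda\mathsf R]$: $\Pi\Rightarrow\Sigma,A\{x:=B\}\vec C\ /\ \Pi\Rightarrow\Sigma,(\lambda x.A)B\vec C$, if $B$ is free for $x$ in $A$. - $[\subset\mathsf L]$: $\Pi,B\vec C\Rightarrow\Sigma$ and $\Pi\Rightarrow\Sigma,A\vec C\ /\ \Pi,A\subset B\Rightarrow\Sigma$. - $[\subset\mathsf R]$: $\Pi,A\vec c\Rightarrow\Sigma,B\vec c\ /\ \Pi\Rightarrow\Sigma,A\subset B$, if the constants $\vec c$ are fresh (pairwise distinct and not occurring in the conclusion). **Provability.** Let $\mathcal C$ be a language with $\mathcal L\cap\mathcal C=\varnothing$ and each $\mathcal C_\alpha$ denumerably infinite. A sequent $\Pi\Rightarrow\Sigma$ of $\mathcal L$ is provable, written $\Pi\vdash\Sigma$, if there are finite $\Pi_0\subseteq\Pi$ and $\Sigma_0\subseteq\Sigma$ such that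 $\Pi_0\Rightarrow\Sigma_0$ has a (finite) derivation by the rules above, where the sequents, terms and fresh constants occurring in the derivation may be taken from the language $\mathcal L\cup\mathcal C$. *)

(* Defs.v *)
From HB Require Import structures.
From mathcomp Require Import all_boot.
From mathcomp Require Import boolp classical_sets functions cardinality.

Set Implicit Arguments.
Unset Strict Implicit.
Unset Printing Implicit Defensive.

Local Open Scope classical_set_scope.

(* [Complex [:: a1; ...; an]] is the type <a1 ... an>. *)
Inductive ty (B : Type) : Type :=
| Basic of B
| Complex of seq (ty B).
Arguments Basic {B}.
Arguments Complex {B}.

Fixpoint ty_encode (B : Type) (a : ty B) : GenTree.tree B :=
  match a with
  | Basic b => GenTree.Leaf b
  | Complex s => GenTree.Node 0 (map (@ty_encode B) s)
  end.

Fixpoint ty_decode (B : Type) (t : GenTree.tree B) : ty B :=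
  match t with
  | GenTree.Leaf b => Basic b
  | GenTree.Node _ s => Complex (map (@ty_decode B) s)
  end.

Lemma ty_encodeK (B : Type) : cancel (@ty_encode B) (@ty_decode B).
Proof.
rewrite /cancel; fix IH 1; case=> [b|s]; first exact: erefl.
rewrite /=; congr Complex; elim: s => [|a s IHs]; first exact: erefl.
by rewrite /= IHs IH.
Qed.

HB.instance Definition _ (B : countType) :=
  Countable.copy (ty B) (can_type (@ty_encodeK B)).

Notation formula_ty := (Complex [::]).

(* The product [T a1 * ... * T an] (times [unit]); for n = 0 this is the
   one-point type [unit], whose point [tt] is the empty tuple. *)
Fixpoint tup (B : Type) (T : ty B -> Type) (s : seq (ty B)) : Type :=
  match s with
  | [::] => unit
  | a :: s' => (T a * tup T s')%type
  end.

(* Countability of the set of constants is part of [countType]. *)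
Record language (B : finType) := Language {
  con :> countType;
  con_ty : con -> ty B }.
Arguments con_ty {B} l c.

(* Constants of two languages are tagged, hence never shared. *)
Definition lang_union (B : finType) (L C : language B) : language B :=
  @Language B (con L + con C)%type
    (fun c => match c with inl c => con_ty L c | inr c => con_ty C c end).

(* The variable [(a, n)] is the n-th variable of type [a = (a, n).1]. *)
Definition var (B : finType) := (ty B * nat)%type.

Inductive term (B : finType) (L : language B) : ty B -> Type :=
| Const (c : L) : term L (con_ty L c)
| Var (x : var B) : term L x.1
| Bot : term L formula_ty
| App (a : ty B) (s : seq (ty B)) :
    term L (Complex (a :: s)) -> term L a -> term L (Complex s)
| Lam (x : var B) (s : seq (ty B)) :
    term L (Complex s) -> term L (Complex (x.1 :: s))
| Inc (s : seq (ty B)) :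
    term L (Complex s) -> term L (Complex s) -> term L formula_ty.
Arguments Const {B L}.
Arguments Var {B} L.
Arguments Bot {B L}.
Arguments App {B L a s}.
Arguments Lam {B L} x {s}.
Arguments Inc {B L s}.

Fixpoint fv (B : finType) (L : language B) (a : ty B) (A : term L a)
    : seq (var B) :=
  match A with
  | Const _ => [::]
  | Var x => [:: x]
  | Bot => [::]
  | App _ _ A1 A2 => fv A1 ++ fv A2
  | Lam x _ A1 => [seq y <- fv A1 | y != x]
  | Inc _ A1 A2 => fv A1 ++ fv A2
  end.

Definition closed_term (B : finType) (L : language B) (a : ty B) (A : term L a)
  : bool := nilp (fv A).

Fixpoint consts (B : finType) (L : language B) (a : ty B) (A : term L a)
    : seq (con L) :=
  match A with
  | Const c => [:: c]
  | Var _ => [::]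
  | Bot => [::]
  | App _ _ A1 A2 => consts A1 ++ consts A2
  | Lam _ _ A1 => consts A1
  | Inc _ A1 A2 => consts A1 ++ consts A2
  end.

(* [subst x b A] is A{x := b}: only free occurrences are replaced, and bound
   variables are never renamed. *)
Fixpoint subst (B : finType) (L : language B) (x : var B) (b : term L x.1)
    (a : ty B) (A : term L a) : term L a :=
  match A in term _ a0 return term L a0 with
  | Const c => Const c
  | Var y => dfwith (T := fun z : var B => term L z.1) (Var L) b y
  | Bot => Bot
  | App _ _ A1 A2 => App (subst b A1) (subst b A2)
  | Lam y _ A1 => Lam y (if y == x then A1 else subst b A1)
  | Inc _ A1 A2 => Inc (subst b A1) (subst b A2)
  end.

(* [free_for x b A]: b is free for x in A, i.e. no free occurrence of x in A
   is in the scope of a binder of a variable free in b. *)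
Fixpoint free_for (B : finType) (L : language B) (x : var B) (b : term L x.1)
    (a : ty B) (A : term L a) : bool :=
  match A with
  | Const _ | Var _ | Bot => true
  | App _ _ A1 A2 => free_for b A1 && free_for b A2
  | Lam y _ A1 =>
      (y == x) || (((x \in fv A1) ==> (y \notin fv b)) && free_for b A1)
  | Inc _ A1 A2 => free_for b A1 && free_for b A2
  end.

Arguments subst {B L} x b {a} A.
Arguments free_for {B L} x b {a} A.

(* [apps A (C1, (C2, ...))] is the formula A C1 C2 ... *)
Fixpoint apps (B : finType) (L : language B) (s : seq (ty B))
    : term L (Complex s) -> tup (term L) s -> term L formula_ty :=
  match s return term L (Complex s) -> tup (term L) s -> term L formula_ty with
  | [::] => fun A _ => A
  | a :: s' => fun A Cs => apps (App A Cs.1) Cs.2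
  end.

Fixpoint const_tup (B : finType) (L : language B) (cs : seq (con L))
    : tup (term L) (map (con_ty L) cs) :=
  match cs return tup (term L) (map (con_ty L) cs) with
  | [::] => tt
  | c :: cs' => (Const c, const_tup cs')
  end.

(* The inclusion of the terms of L into those of the union of L and C. *)
Fixpoint emb (B : finType) (L C : language B) (a : ty B) (A : term L a)
    : term (lang_union L C) a :=
  match A in term _ a0 return term (lang_union L C) a0 with
  | Const c => @Const B (lang_union L C) (inl c)
  | Var x => Var (lang_union L C) x
  | Bot => Bot
  | App _ _ A1 A2 => App (emb C A1) (emb C A2)
  | Lam x _ A1 => Lam x (emb C A1)
  | Inc _ A1 A2 => Inc (emb C A1) (emb C A2)
  end.

Lemma fv_emb (B : finType) (L C : language B) (a : ty B) (A : term L a) :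
  fv (emb C A) = fv A.
Proof. by elim: A => //= [? ? ? -> ? -> | ? ? ? -> | ? ? -> ? ->]. Qed.

Record sentence (B : finType) (L : language B) := Sentence {
  form :> term L formula_ty;
  form_closed : closed_term form }.
Arguments Sentence {B L form}.

Lemma closed_emb (B : finType) (L C : language B) (phi : sentence L) :
  closed_term (emb C phi).
Proof. by rewrite /closed_term fv_emb; exact: form_closed. Qed.

Definition emb_sentence (B : finType) (L C : language B) (phi : sentence L)
  : sentence (lang_union L C) := Sentence (closed_emb C phi).

(* A family of types indexed by [ty B] is automatically pairwise disjoint. *)
Definition assignment (B : finType) (D : ty B -> Type) : Type :=
  forall x : var B, D x.1.

Definition upd (B : finType) (D : ty B -> Type) (a : assignment D)
    (x : var B) (d : D x.1) : assignment D :=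
  dfwith (T := fun z : var B => D z.1) a d.
Arguments upd {B D} a x d.

Definition is_intension (B : finType) (L : language B) (D : ty B -> Type)
    (I : assignment D -> forall t : ty B, term L t -> D t) : Prop :=
  [/\ forall a (x : var B), I a x.1 (Var L x) = a x,
      forall a a' (t : ty B) (A : term L t),
        (forall x, x \in fv A -> a x = a' x) -> I a t A = I a' t A
    & forall a (x : var B) (b : term L x.1) (t : ty B) (A : term L t),
        free_for x b A ->
        I a t (subst x b A) = I (upd a x (I a x.1 b)) t A].

Record intensional_model (B : finType) (L : language B) := IntensionalModel {
  dom : ty B -> Type;
  dom_inhabited : forall t, inhabited (dom t);
  intn : assignment dom -> forall t : ty B, term L t -> dom t;
  intnP : is_intension intn;
  extn : forall s : seq (ty B), dom (Complex s) -> set (tup dom s);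
  (* In the clauses below, [extn (intn a A)] is V(a, A); the truth values 0
     and 1 are [set0] and [[set tt]]. *)
  extn_bot : forall a, extn (intn a Bot) = set0;
  extn_app : forall a (t : ty B) (s : seq (ty B))
      (A : term L (Complex (t :: s))) (b : term L t),
    extn (intn a (App A b)) =
      [set ds : tup dom s | extn (intn a A) (intn a b, ds)];
  extn_lam : forall a (x : var B) (s : seq (ty B)) (A : term L (Complex s)),
    extn (intn a (Lam x A)) =
      [set ds : tup dom (x.1 :: s) | extn (intn (upd a x ds.1) A) ds.2];
  extn_inc : forall a (s : seq (ty B)) (A A' : term L (Complex s)),
    extn (intn a (Inc A A')) = [set tt] <->
      extn (intn a A) `<=` extn (intn a A') }.

Definition val_ext (B : finType) (L : language B) (M : intensional_model L)
    (a : assignment (dom M)) (s : seq (ty B)) (A : term L (Complex s))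
  : set (tup (dom M) s) := extn (intn a A).

Definition satisfies (B : finType) (L : language B) (M : intensional_model L)
    (phi : sentence L) : Prop :=
  exists a : assignment (dom M), val_ext a phi = [set tt].

Inductive side := Lft | Rgt.

Definition sequent (B : finType) (L : language B) := set (side * sentence L).

Definition mkseq (B : finType) (L : language B) (Pi Sigma : set (sentence L))
  : sequent L :=
  [set s | match s.1 with Lft => Pi s.2 | Rgt => Sigma s.2 end].
Notation "Pi ==>s Sigma" := (mkseq Pi Sigma) (at level 92, no associativity).
Notation "Pi ,+ phi" := (Pi `|` [set phi]) (at level 91, left associativity).

Definition refutes (B : finType) (L : language B) (M : intensional_model L)
    (G : sequent L) : Prop :=
  (forall phi, G (Lft, phi) -> satisfies M phi) /\
  (forall phi, G (Rgt, phi) -> ~ satisfies M phi).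

Definition i_valid (B : finType) (L : language B) (G : sequent L) : Prop :=
  ~ exists M : intensional_model L, refutes M G.

Definition i_entails (B : finType) (L : language B)
    (Pi Sigma : set (sentence L)) : Prop := i_valid (Pi ==>s Sigma).

Definition fresh (B : finType) (L : language B) (cs : seq (con L))
    (G : sequent L) : Prop :=
  uniq cs /\
  forall c, c \in cs -> forall s, G s -> c \notin consts (s.2 : term L formula_ty).

(* The hypotheses [h], [h1], [h2] say that the displayed formulas are closed;
   in particular all arguments [Cs] are closed terms. *)
Inductive derivable (B : finType) (L : language B) : sequent L -> Prop :=
| RuleW (Pi Sigma Pi' Sigma' : set (sentence L)) :
    Pi `<=` Pi' -> Sigma `<=` Sigma' ->
    derivable (Pi ==>s Sigma) -> derivable (Pi' ==>s Sigma')
| RuleR (Pi Sigma : set (sentence L)) (phi : sentence L) :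
    derivable (Pi ,+ phi ==>s Sigma ,+ phi)
| RuleBotL (Pi Sigma : set (sentence L)) (h : closed_term (@Bot B L)) :
    derivable (Pi ,+ Sentence h ==>s Sigma)
| RuleLamL (Pi Sigma : set (sentence L)) (x : var B) (s : seq (ty B))
    (A : term L (Complex s)) (b : term L x.1) (Cs : tup (term L) s)
    (h1 : closed_term (apps (subst x b A) Cs))
    (h : closed_term (apps (App (Lam x A) b) Cs)) :
    free_for x b A ->
    derivable (Pi ,+ Sentence h1 ==>s Sigma) ->
    derivable (Pi ,+ Sentence h ==>s Sigma)
| RuleLamR (Pi Sigma : set (sentence L)) (x : var B) (s : seq (ty B))
    (A : term L (Complex s)) (b : term L x.1) (Cs : tup (term L) s)
    (h1 : closed_term (apps (subst x b A) Cs))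
    (h : closed_term (apps (App (Lam x A) b) Cs)) :
    free_for x b A ->
    derivable (Pi ==>s Sigma ,+ Sentence h1) ->
    derivable (Pi ==>s Sigma ,+ Sentence h)
| RuleIncL (Pi Sigma : set (sentence L)) (s : seq (ty B))
    (A A' : term L (Complex s)) (Cs : tup (term L) s)
    (h1 : closed_term (apps A' Cs)) (h2 : closed_term (apps A Cs))
    (h : closed_term (Inc A A')) :
    derivable (Pi ,+ Sentence h1 ==>s Sigma) ->
    derivable (Pi ==>s Sigma ,+ Sentence h2) ->
    derivable (Pi ,+ Sentence h ==>s Sigma)
| RuleIncR (Pi Sigma : set (sentence L)) (cs : seq (con L))
    (A A' : term L (Complex (map (con_ty L) cs)))
    (h1 : closed_term (apps A (const_tup cs)))
    (h2 : closed_term (apps A' (const_tup cs)))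
    (h : closed_term (Inc A A')) :
    fresh cs (Pi ==>s Sigma ,+ Sentence h) ->
    derivable (Pi ,+ Sentence h1 ==>s Sigma ,+ Sentence h2) ->
    derivable (Pi ==>s Sigma ,+ Sentence h).

(* Derivations take place in the union of L and the language C of additional
   constants. *)
Definition provable (B : finType) (L C : language B) (G : sequent L) : Prop :=
  exists Pi0 Sigma0 : set (sentence L),
    [/\ finite_set Pi0, finite_set Sigma0, (Pi0 ==>s Sigma0) `<=` G
      & derivable (emb_sentence C @` Pi0 ==>s emb_sentence C @` Sigma0)].

Definition entails (B : finType) (L C : language B)
    (Pi Sigma : set (sentence L)) : Prop := provable C (Pi ==>s Sigma).

(* Main.v *)
Require Import Defs.
From mathcomp Require Import all_boot.
From mathcomp Require Import boolp classical_sets functions cardinality.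

Set Implicit Arguments.
Unset Strict Implicit.
Unset Printing Implicit Defensive.

Local Open Scope classical_set_scope.

(** A sequent that is not provable is refuted by a model built from syntax. The
    calculus has no cut rule, and this shapes the construction.

    An unprovable sequent of L is first extended to a sequent of the union of L
    and C that is maximal among those without a derivable finite subsequent
    ([saturation]). The sentences are countable, so they can be added one by
    one; an inclusion of A in A' that is added on the right comes with A c1 ... cn
    on the left and A' c1 ... cn on the right, for fresh constants ci. Enough of
    them remain at every stage, because only finitely many sentences have been
    added to a sequent of L so far. By maximality the result is closed under
    the rules read from conclusion to premises, that is, it is a Hintikka set
    ([saturated_hintikka]).

    Without cut, a Hintikka set need not decide every sentence, and the closed
    terms alone do not determine a model. The remedy is that of Takahashi and
    Prawitz: an element of the model of complex type is a pair of a closed term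
    A and a possible extension of A, that is, a set of tuples of elements that
    agrees with the Hintikka set wherever the latter decides an application of
    A. The intension of a term under an assignment is the pair formed by the
    term, with the names of the values substituted for its free variables, and
    the extension that the truth clauses dictate. The truth clauses then hold by
    construction, and the point to prove is that the extension so computed is a
    possible one ([name_interp] and the lemmas [possible_App], [possible_Inc],
    [possible_Lam]); the closure properties of the Hintikka set say just this.
    Intensionality is essential: elements with the same extension but different
    names are kept apart.

    Finally, a sentence in the Hintikka set is its own name, so its truth value
    is a possible extension of itself and agrees with its sign
    ([hintikka_modelP]); restricting the model to L refutes the given
    sequent. *)

(** * Substitution *)

Section Substitution.
Variables (B : finType) (L : language B).
Implicit Types (x y z : var B) (t : ty B) (s : seq (ty B)).

Lemma upd_same (D : ty B -> Type) (a : assignment D) x (d : D x.1) :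
  upd a x d x = d.
Proof. exact: dfwith_in. Qed.

Lemma upd_other (D : ty B -> Type) (a : assignment D) x (d : D x.1) y :
  y != x -> upd a x d y = a y.
Proof. by rewrite eq_sym; exact: dfwith_out. Qed.

Lemma mem_fv_Lam x y s (A : term L (Complex s)) :
  (y \in fv (Lam x A)) = (y != x) && (y \in fv A).
Proof. by rewrite mem_filter. Qed.

Lemma closed_fv t (A : term L t) x : closed_term A -> x \notin fv A.
Proof. by move=> /nilP ->. Qed.

Lemma closed_termP t (A : term L t) :
  (forall x, x \notin fv A) -> closed_term A.
Proof.
rewrite /closed_term; case: (fv A) => // x r /(_ x).
by rewrite mem_head.
Qed.

Lemma closed_App t s (A : term L (Complex (t :: s))) (b : term L t) :
  closed_term (App A b) = closed_term A && closed_term b.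
Proof. by rewrite /closed_term /=; case: (fv A). Qed.

Lemma closed_Inc s (A A' : term L (Complex s)) :
  closed_term (Inc A A') = closed_term A && closed_term A'.
Proof. by rewrite /closed_term /=; case: (fv A). Qed.

Lemma free_for_closed x (b : term L x.1) t (A : term L t) :
  closed_term b -> free_for x b A.
Proof.
move=> cb; elim: A => //= [? ? ? -> ? -> | y ? ? -> | ? ? -> ? ->] //.
by rewrite closed_fv // implybT orbT.
Qed.

Fixpoint msubst (f : assignment (term L)) t (A : term L t) : term L t :=
  match A in term _ t0 return term L t0 with
  | Const c => Const c
  | Var x => f x
  | Bot => Bot
  | App _ _ A1 A2 => App (msubst f A1) (msubst f A2)
  | Lam x _ A1 => Lam x (msubst (upd f x (Var L x)) A1)
  | Inc _ A1 A2 => Inc (msubst f A1) (msubst f A2)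
  end.

Lemma eq_msubst t (A : term L t) (f g : assignment (term L)) :
  (forall x, x \in fv A -> f x = g x) -> msubst f A = msubst g A.
Proof.
elim: A f g => //=.
- by move=> x f g; apply; rewrite inE.
- move=> ? ? A IHA b IHb f g fg.
  by rewrite (IHA f g) ?(IHb f g) // => x xA; apply: fg; rewrite mem_cat xA ?orbT.
- move=> x s A IHA f g fg; congr Lam; apply: IHA => y yA.
  have [->|yx] := eqVneq y x; first by rewrite !upd_same.
  by rewrite !upd_other //; apply: fg; rewrite mem_filter yx.
- move=> ? A IHA b IHb f g fg.
  by rewrite (IHA f g) ?(IHb f g) // => x xA; apply: fg; rewrite mem_cat xA ?orbT.
Qed.

Lemma msubst_Var t (A : term L t) : msubst (Var L) A = A.
Proof.
elim: A => //= [? ? ? -> ? -> | x s A IHA | ? ? -> ? ->] //.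
congr Lam; rewrite -[RHS]IHA; apply: eq_msubst => y _.
by have [->|yx] := eqVneq y x; rewrite ?upd_same ?upd_other.
Qed.

Lemma msubst_closed (f : assignment (term L)) t (A : term L t) :
  closed_term A -> msubst f A = A.
Proof.
move=> cA; rewrite -[RHS]msubst_Var; apply: eq_msubst => x xA.
by rewrite (negPf (closed_fv x cA)) in xA.
Qed.

Lemma substE x (b : term L x.1) t (A : term L t) :
  subst x b A = msubst (upd (Var L) x b) A.
Proof.
elim: A => //= [? ? ? -> ? -> | y s A IHA | ? ? -> ? ->] //.
congr Lam; case: eqP => [->|/eqP yx].
  rewrite -[LHS]msubst_Var; apply: eq_msubst => z _.
  by have [->|zx] := eqVneq z x; rewrite ?upd_same // !upd_other.
rewrite IHA; apply: eq_msubst => z _.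
have [->|zy] := eqVneq z y; first by rewrite upd_same upd_other.
by rewrite [RHS]upd_other.
Qed.

Lemma subst_notin x (b : term L x.1) t (A : term L t) :
  x \notin fv A -> subst x b A = A.
Proof.
move=> xA; rewrite substE -[RHS]msubst_Var; apply: eq_msubst => y yA.
by rewrite upd_other //; apply: contraNneq xA => <-.
Qed.

Lemma fv_msubst (f : assignment (term L)) t (A : term L t) z :
  z \in fv (msubst f A) -> exists2 x, x \in fv A & z \in fv (f x).
Proof.
elim: A f => //=.
- by move=> x f zx; exists x; rewrite ?inE.
- move=> ? ? A IHA b IHb f; rewrite mem_cat => /orP[/IHA|/IHb] [x xA zx];
  by exists x; rewrite // mem_cat xA ?orbT.
- move=> x s A IHA f; rewrite mem_filter => /andP[zx /IHA[y yA]].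
  have [->|yx] := eqVneq y x; first by rewrite upd_same inE (negPf zx).
  by rewrite upd_other // => zy; exists y; rewrite // mem_filter yx.
- move=> ? A IHA b IHb f; rewrite mem_cat => /orP[/IHA|/IHb] [x xA zx];
  by exists x; rewrite // mem_cat xA ?orbT.
Qed.

Lemma closed_msubst (f : assignment (term L)) t (A : term L t) :
  (forall x, closed_term (f x)) -> closed_term (msubst f A).
Proof.
move=> cf; apply: closed_termP => z; apply/negP => /fv_msubst[x _].
by apply/negP/closed_fv.
Qed.

(** Simultaneous substitution turns a capture-free substitution into an update
    of the environment; on the names of elements this is what the substitution
    clause of intension functions demands. *)
Lemma msubst_subst (f : assignment (term L)) x (b : term L x.1) t
    (A : term L t) :
  free_for x b A -> msubst f (subst x b A) = msubst (upd f x (msubst f b)) A.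
Proof.
elim: A f => //=.
- move=> y f _; have [->|yx] := eqVneq y x.
    by rewrite dfwith_in upd_same.
  by rewrite upd_other // dfwith_out // eq_sym.
- by move=> ? ? A IHA b' IHb f /andP[/IHA-> /IHb->].
- move=> y s A IHA f ff; congr Lam; move: ff; case: eqP => [-> _|/eqP yx /=].
    apply: eq_msubst => z _.
    by have [->|zx] := eqVneq z x; rewrite ?upd_same // !upd_other.
  move=> /andP[xA /IHA->]; apply: eq_msubst => z zA.
  have [zx|zx] := eqVneq z x.
    subst z; rewrite upd_same upd_other 1?eq_sym // upd_same.
    apply: eq_msubst => w wb; rewrite upd_other //.
    by apply: contraTneq wb => ->; exact: (implyP xA zA).
  rewrite upd_other //; have [->|zy] := eqVneq z y; first by rewrite !upd_same.
  by rewrite !upd_other.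
- by move=> ? A IHA b' IHb f /andP[/IHA-> /IHb->].
Qed.

Lemma subst_msubst (f : assignment (term L)) x (b : term L x.1) t
    (A : term L t) :
  (forall y, y != x -> x \notin fv (f y)) ->
  subst x b (msubst f A) = msubst (fun y => subst x b (f y)) A.
Proof.
elim: A f => //=.
- by move=> ? ? A IHA b' IHb f xf; rewrite IHA ?IHb.
- move=> y s A IHA f xf; congr Lam; case: eqP => [yx|/eqP yx].
    subst y; apply: eq_msubst => z _.
    have [->|zx] := eqVneq z x; first by rewrite !upd_same.
    by rewrite !upd_other // subst_notin // xf.
  rewrite IHA.
    apply: eq_msubst => z _; have [->|zy] := eqVneq z y.
      by rewrite !upd_same /= dfwith_out // eq_sym.
    by rewrite !upd_other.
  move=> z zx; have [->|zy] := eqVneq z y; last by rewrite upd_other ?xf.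
  by rewrite upd_same inE eq_sym.
- by move=> ? A IHA b' IHb f xf; rewrite IHA ?IHb.
Qed.

(** This is how a beta-redex whose body has been instantiated with closed terms
    contracts. *)
Lemma subst_msubst_upd (f : assignment (term L)) x (b : term L x.1) t
    (A : term L t) : (forall y, closed_term (f y)) ->
  subst x b (msubst (upd f x (Var L x)) A) = msubst (upd f x b) A.
Proof.
move=> cf; rewrite subst_msubst => [|y yx].
  apply: eq_msubst => y _; have [->|yx] := eqVneq y x.
    by rewrite !upd_same /= dfwith_in.
  by rewrite !upd_other // subst_notin // closed_fv.
by rewrite upd_other // closed_fv.
Qed.

Lemma closed_subst x (b : term L x.1) s (A : term L (Complex s)) :
  closed_term (Lam x A) -> closed_term b -> closed_term (subst x b A).
Proof.
move=> cA cb; rewrite substE; apply: closed_termP => z.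
apply/negP => /fv_msubst[y yA]; have [yx|yx] := eqVneq y x.
  by subst y; rewrite upd_same (negPf (closed_fv z cb)).
by have := closed_fv y cA; rewrite mem_fv_Lam yx yA.
Qed.

Fixpoint closed_tup s : tup (term L) s -> bool :=
  match s return tup (term L) s -> bool with
  | [::] => fun=> true
  | t :: s' => fun Cs => closed_term Cs.1 && closed_tup Cs.2
  end.

Lemma closed_apps s (A : term L (Complex s)) (Cs : tup (term L) s) :
  closed_term (apps A Cs) = closed_term A && closed_tup Cs.
Proof.
elim: s A Cs => [|t s IHs] A Cs /=; first by rewrite andbT.
by rewrite IHs closed_App andbA.
Qed.

Lemma closed_const_tup (cs : seq (con L)) : closed_tup (const_tup cs).
Proof. by elim: cs => //= c cs ->. Qed.

End Substitution.

(** * The model of a Hintikka set *)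

Fixpoint tup_map (B : Type) (T U : ty B -> Type) (f : forall t, T t -> U t)
    (s : seq (ty B)) : tup T s -> tup U s :=
  match s return tup T s -> tup U s with
  | [::] => id
  | t :: s' => fun ds => (f t ds.1, tup_map f ds.2)
  end.

(** The set is given by the relation between signs and formulas. It may leave
    sentences undecided, as maximality yields no more without a cut rule. *)
Record hintikka (B : finType) (L : language B)
    (H : side -> term L formula_ty -> Prop) : Prop := Hintikka {
  hint_clash : forall A, H Lft A -> ~ H Rgt A;
  hint_bot : ~ H Lft Bot;
  hint_lam : forall sd (x : var B) s (A : term L (Complex s)) (b : term L x.1)
      (Cs : tup (term L) s), closed_term b ->
    H sd (apps (App (Lam x A) b) Cs) -> H sd (apps (subst x b A) Cs);
  hint_incL : forall s (A A' : term L (Complex s)) (Cs : tup (term L) s),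
    closed_tup Cs -> H Lft (Inc A A') ->
    H Lft (apps A' Cs) \/ H Rgt (apps A Cs);
  hint_incR : forall s (A A' : term L (Complex s)),
    H Rgt (Inc A A') -> exists Cs : tup (term L) s,
      [/\ closed_tup Cs, H Lft (apps A Cs) & H Rgt (apps A' Cs)] }.

Section HintikkaModel.
Variables (B : finType) (L : language B).
Variable H : side -> term L formula_ty -> Prop.
Hypothesis hintH : hintikka H.
Variable default : forall t : ty B, term L t.
Hypothesis closed_default : forall t, closed_term (default t).
Implicit Types (x y : var B) (t : ty B) (s : seq (ty B)).

(** The set e is a possible extension of A: it respects all the verdicts of the
    Hintikka set on applications of A. The set usually leaves many applications
    undecided, so that one term may have several possible extensions. *)
Definition possible (T : ty B -> Type) (name : forall t, T t -> term L t) s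
    (A : term L (Complex s)) (e : set (tup T s)) : Prop :=
  closed_term A /\ forall ds,
    (H Lft (apps A (tup_map name ds)) -> e ds) /\
    (H Rgt (apps A (tup_map name ds)) -> ~ e ds).

(** The domain and the map that names its elements have to be defined together:
    the possible extensions at a complex type are sets of tuples of elements of
    lower domains, and possibility refers to the names of these elements. *)
Fixpoint named_dom t : {T : Type & T -> term L t} :=
  match t return {T : Type & T -> term L t} with
  | Basic b => existT (fun T => T -> term L (Basic b))
      {A : term L (Basic b) | closed_term A} sval
  | Complex s => existT (fun T => T -> term L (Complex s))
      {p : term L (Complex s) * set (tup (fun t => projT1 (named_dom t)) s) |
        possible (fun t => projT2 (named_dom t)) p.1 p.2}
      (fun d => (sval d).1)
  end.

Definition hdom t : Type := projT1 (named_dom t).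
Definition name t : hdom t -> term L t := projT2 (named_dom t).
Definition hext s (d : hdom (Complex s)) : set (tup hdom s) := (sval d).2.

Lemma closed_name t (d : hdom t) : closed_term (name d).
Proof. by case: t d => [b|s] [d /= hd] //; case: hd. Qed.

Lemma closed_names s (ds : tup hdom s) : closed_tup (tup_map name ds).
Proof. by elim: s ds => //= t s IHs ds; rewrite closed_name IHs. Qed.

Lemma possible_hext s (d : hdom (Complex s)) : possible name (name d) (hext d).
Proof. by case: d. Qed.

(** Among the possible extensions of a closed term there is a least one. *)
Lemma possible_least s (A : term L (Complex s)) : closed_term A ->
  possible name A [set ds | H Lft (apps A (tup_map name ds))].
Proof. by move=> cA; split=> // ds; split=> // HR /hint_clash; apply. Qed.

Definition least t : forall A : term L t, closed_term A -> hdom t :=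
  match t return forall A : term L t, closed_term A -> hdom t with
  | Basic b => fun A cA => exist (fun A0 : term L (Basic b) => closed_term A0) A cA
  | Complex s => fun A cA =>
      exist (fun p => possible name p.1 p.2) (A, _) (possible_least cA)
  end.

Lemma name_least t (A : term L t) (cA : closed_term A) : name (least cA) = A.
Proof. by case: t A cA. Qed.

(** The default value for impossible extensions makes the interpretation below a
    plain recursion on terms, so that possibility can be proved afterwards, by
    an induction that reasons about the finished interpretation. *)
Definition mk s (A : term L (Complex s)) (e : set (tup hdom s))
    : hdom (Complex s) :=
  match pselect (possible name A e) with
  | left p => exist (fun p => possible name p.1 p.2) (A, e) p
  | right _ => least (closed_default (Complex s))
  end.

Lemma mkP s (A : term L (Complex s)) (e : set (tup hdom s)) :
  possible name A e -> name (mk A e) = A /\ hext (mk A e) = e.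
Proof. by rewrite /mk; case: pselect. Qed.

Definition names (a : assignment hdom) : assignment (term L) :=
  fun x => name (a x).

Fixpoint interp (a : assignment hdom) t (A : term L t) : hdom t :=
  match A in term _ t0 return hdom t0 with
  | Const c => least (isT : closed_term (Const c))
  | Var x => a x
  | Bot => @mk [::] Bot set0
  | App t s A1 A2 =>
      mk (App (name (interp a A1)) (name (interp a A2)))
         [set ds | hext (interp a A1) (interp a A2, ds)]
  | Lam x s A1 =>
      mk (Lam x (msubst (upd (names a) x (Var L x)) A1))
         [set ds : tup hdom (x.1 :: s) |
           hext (interp (upd a x ds.1) A1) ds.2]
  | Inc s A1 A2 =>
      @mk [::] (Inc (name (interp a A1)) (name (interp a A2)))
         [set _ | hext (interp a A1) `<=` hext (interp a A2)]
  end.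

Lemma names_upd a x (d : hdom x.1) y :
  names (upd a x d) y = upd (names a) x (name d) y.
Proof.
rewrite /names; have [->|yx] := eqVneq y x; first by rewrite !upd_same.
by rewrite !upd_other.
Qed.

Lemma possible_Bot : @possible hdom name [::] Bot set0.
Proof. by split=> // ds; split=> [HL|_ []]; case: (hint_bot hintH HL). Qed.

Lemma possible_App t s (d : hdom (Complex (t :: s))) (d' : hdom t) :
  possible name (App (name d) (name d')) [set ds | hext d (d', ds)].
Proof.
have [cd dP] := possible_hext d.
by split=> [|ds]; [rewrite closed_App cd closed_name | exact: (dP (d', ds))].
Qed.

(** Every closed term has a possible extension, so the closed terms that refute
    an inclusion syntactically yield a refuting point of the model. *)
Lemma names_surj s (Cs : tup (term L) s) :
  closed_tup Cs -> exists ds : tup hdom s, tup_map name ds = Cs.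
Proof.
elim: s Cs => [|t s IHs] /= => [[] _|[A Cs] /= /andP[cA /IHs[ds <-]]].
  by exists tt.
by exists (least cA, ds); rewrite /= name_least.
Qed.

Lemma possible_Inc s (d d' : hdom (Complex s)) :
  @possible hdom name [::] (Inc (name d) (name d'))
    [set _ | hext d `<=` hext d'].
Proof.
split=> [|ds]; first by rewrite closed_Inc !closed_name.
split=> /= [HL es eds|/(hint_incR hintH)[Cs [cCs HL HR]] sub].
  have [_ /(_ es)[dL dR]] := possible_hext d.
  have [_ /(_ es)[dL' dR']] := possible_hext d'.
  by case: (hint_incL hintH (closed_names es) HL) => [/dL'|/dR].
have [es esE] := names_surj cCs.
have [_ /(_ es)[dL dR]] := possible_hext d.
have [_ /(_ es)[dL' dR']] := possible_hext d'.
by rewrite esE in dL dR'; apply: dR' => //; apply: sub; exact: dL.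
Qed.

(** If the beta-redex is in the Hintikka set then so is its contractum, which
    is the name of the value of the body at the updated assignment. *)
Lemma possible_Lam a x s (A : term L (Complex s)) :
  (forall a', name (interp a' A) = msubst (names a') A) ->
  possible name (Lam x (msubst (upd (names a) x (Var L x)) A))
    [set ds : tup hdom (x.1 :: s) | hext (interp (upd a x ds.1) A) ds.2].
Proof.
move=> nmA; have ca y : closed_term (names a y) by exact: closed_name.
split=> [|[d ds]].
  have -> : Lam x (msubst (upd (names a) x (Var L x)) A) =
    msubst (names a) (Lam x A) by [].
  exact: closed_msubst.
have redE : subst x (name d) (msubst (upd (names a) x (Var L x)) A) =
    name (interp (upd a x d) A).
  rewrite subst_msubst_upd // nmA; apply: eq_msubst => y _.
  by rewrite names_upd.
have [_ /(_ ds)[AL AR]] := possible_hext (interp (upd a x d) A).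
split=> /(hint_lam hintH (closed_name d)); rewrite redE; [exact: AL|exact: AR].
Qed.

Lemma name_interp a t (A : term L t) : name (interp a A) = msubst (names a) A.
Proof.
elim: A a => [c|x||t' s A IHA b IHb|x s A IHA|s A IHA b IHb] a //=.
- exact: name_least.
- by rewrite (mkP possible_Bot).1.
- by rewrite (mkP (possible_App _ _)).1 IHA IHb.
- by rewrite (mkP (possible_Lam _ _ IHA)).1.
- by rewrite (mkP (possible_Inc _ _)).1 IHA IHb.
Qed.

(** Equality of the names and of the extensions suffices, as both arguments of
    [mk] determine the element. *)
Lemma eq_interp t (A : term L t) a a' :
  (forall x, x \in fv A -> a x = a' x) -> interp a A = interp a' A.
Proof.
elim: A a a' => //=.
- by move=> x a a'; apply; rewrite inE.
- move=> t' s A IHA b IHb a a' aa'.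
  by rewrite (IHA a a') ?(IHb a a') // => x xA; apply: aa';
    rewrite mem_cat xA ?orbT.
- move=> x s A IHA a a' aa'; congr (mk (Lam x _) _).
    apply: eq_msubst => y yA.
    have [->|yx] := eqVneq y x; first by rewrite !upd_same.
    by rewrite !upd_other // /names aa' // mem_filter yx.
  rewrite predeqE => ds /=; rewrite (IHA _ (upd a' x ds.1)) // => y yA.
  have [->|yx] := eqVneq y x; first by rewrite !upd_same.
  by rewrite !upd_other // aa' // mem_filter yx.
- move=> s A IHA b IHb a a' aa'.
  by rewrite (IHA a a') ?(IHb a a') // => x xA; apply: aa';
    rewrite mem_cat xA ?orbT.
Qed.

Lemma interp_subst a x (b : term L x.1) t (A : term L t) :
  free_for x b A -> interp a (subst x b A) = interp (upd a x (interp a b)) A.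
Proof.
elim: A a => //=.
- move=> y a _; have [->|yx] := eqVneq y x.
    by rewrite dfwith_in upd_same.
  by rewrite upd_other // dfwith_out // eq_sym.
- by move=> t' s A IHA b' IHb a /andP[/IHA-> /IHb->].
- move=> y s A IHA a; have [yx _|yx ff] := eqVneq y x.
    rewrite yx; apply: (@eq_interp _ (Lam x A)) => z.
    by rewrite mem_fv_Lam => /andP[zx _]; rewrite upd_other.
  move: ff => /= /andP[xA ffA].
  congr (mk (Lam y _) _).
    rewrite msubst_subst //; apply: eq_msubst => z zA.
    have [zx|zx] := eqVneq z x.
      subst z; rewrite upd_same upd_other 1?eq_sym // names_upd upd_same.
      rewrite name_interp; apply: eq_msubst => w wb; rewrite upd_other //.
      by apply: contraTneq wb => ->; exact: (implyP xA zA).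
    rewrite upd_other //; have [->|zy] := eqVneq z y; first by rewrite !upd_same.
    by rewrite !upd_other // names_upd upd_other.
  rewrite predeqE => ds /=; rewrite IHA //.
  rewrite (@eq_interp _ _ _ (upd (upd a x (interp a b)) y ds.1)) //.
  move=> z zA; have [zx|zx] := eqVneq z x.
    subst z; rewrite upd_same upd_other 1?eq_sym // upd_same.
    apply: eq_interp => w wb; rewrite upd_other //.
    by apply: contraTneq wb => ->; exact: (implyP xA zA).
  rewrite upd_other //; have [->|zy] := eqVneq z y; first by rewrite !upd_same.
  by rewrite !upd_other.
- by move=> s A IHA b' IHb a /andP[/IHA-> /IHb->].
Qed.

Lemma interp_is_intension : is_intension interp.
Proof. by split=> // *; [exact: eq_interp | exact: interp_subst]. Qed.

Definition hintikka_model : intensional_model L.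
Proof.
apply: (@IntensionalModel B L hdom _ interp interp_is_intension hext).
- by move=> t; constructor; exact: (least (closed_default t)).
- by move=> a; rewrite /= (mkP possible_Bot).2.
- by move=> a t s A b; rewrite /= (mkP (possible_App _ _)).2.
- move=> a x s A; rewrite /= (mkP (possible_Lam _ _ _)).2 // => a'.
  exact: name_interp.
- move=> a s A A'; rewrite /= (mkP (possible_Inc _ _)).2; split.
    by move=> e; have : [set tt] tt by []; rewrite -e.
  by move=> sub; rewrite predeqE => -[]; split.
Defined.

Lemma hintikka_modelP (phi : sentence L) :
  (H Lft phi -> satisfies hintikka_model phi) /\
  (H Rgt phi -> ~ satisfies hintikka_model phi).
Proof.
have phiE (a : assignment hdom) : name (interp a phi) = phi.
  by rewrite name_interp msubst_closed //; exact: form_closed.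
have poss a := possible_hext (interp a phi); split.
  move=> HL; exists (fun x => least (closed_default x.1)).
  rewrite /val_ext /= predeqE => -[]; split=> // _.
  by have [_ /(_ tt)[+ _]] := poss (fun x => least (closed_default x.1));
    rewrite phiE; apply.
move=> HR [a]; rewrite /val_ext /= => e.
have [_ /(_ tt)[_]] := poss a; rewrite phiE => /(_ HR); apply.
by have : [set tt] tt by []; rewrite -e.
Qed.

End HintikkaModel.

(** * Countability of the set of sentences *)

Section Coding.
Variables (B : finType) (L : language B).

Fixpoint term_code t (A : term L t) : GenTree.tree (con L + var B) :=
  match A with
  | Const c => GenTree.Leaf (inl c)
  | Var x => GenTree.Leaf (inr x)
  | Bot => GenTree.Node 0 [::]
  | App _ _ A1 A2 => GenTree.Node 1 [:: term_code A1; term_code A2]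
  | Lam x _ A1 => GenTree.Node 2 [:: GenTree.Leaf (inr x); term_code A1]
  | Inc _ A1 A2 => GenTree.Node 3 [:: term_code A1; term_code A2]
  end.

(** Equality of total terms rather than of terms, because the code also
    determines the type. *)
Lemma term_code_inj t (A : term L t) t' (A' : term L t') :
  term_code A = term_code A' -> Tagged (term L) A = Tagged (term L) A'.
Proof.
elim: A t' A' => [c|x||u s A IHA b IHb|x s A IHA|s A IHA b IHb] t'
  [c'|x'||u' s' A' b'|x' s' A'|s' A' b'] //=.
- by case=> ->.
- by case=> ->.
- case=> /IHA eA /IHb eb; have [eu es] := congr1 (@tag _ _) eA.
  by subst u' s'; rewrite (eq_from_Tagged eA) (eq_from_Tagged eb).
- case=> ex /IHA eA; have [es] := congr1 (@tag _ _) eA.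
  by subst x' s'; rewrite (eq_from_Tagged eA).
- case=> /IHA eA /IHb eb; have [es] := congr1 (@tag _ _) eA.
  by subst s'; rewrite (eq_from_Tagged eA) (eq_from_Tagged eb).
Qed.

Lemma sentence_inj (phi psi : sentence L) : form phi = form psi -> phi = psi.
Proof.
case: phi psi => [A cA] [A' cA'] /= e; subst A'.
by rewrite (bool_irrelevance cA cA').
Qed.

Definition signed_code (p : side * sentence L) : nat :=
  pickle (if p.1 is Lft then true else false, term_code p.2).

Lemma signed_code_inj : injective signed_code.
Proof.
move=> [sd phi] [sd' phi'] /(pcan_inj pickleK)[esd /term_code_inj e].
rewrite (sentence_inj (eq_from_Tagged e)).
by case: sd sd' esd => [] [].
Qed.

End Coding.

(** * Extension of a consistent sequent to a Hintikka set *)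

Section Finiteness.
Variables (T U : Type).

Lemma finite_sub_chain (X : set T) (F : nat -> set T) : finite_set X ->
  (forall m n, m <= n -> F m `<=` F n) ->
  (forall x, X x -> exists n, F n x) -> exists n, X `<=` F n.
Proof.
move=> finX monF XF.
have /choice[f fP] : forall x, exists n, X x -> F n x.
  move=> x; have [/XF[n Fn]|nX] := pselect (X x); first by exists n.
  by exists 0.
have /finite_seqP[r fX] := finite_image f finX.
exists (\max_(i <- r) i) => x Xx; apply: monF (fP x Xx).
have : [set` r] (f x) by rewrite -fX; exists x.
by move=> /= fr; rewrite (big_rem _ fr) /= leq_maxl.
Qed.

Lemma finite_sub_image (X : set U) (Y : set T) (f : T -> U) : finite_set X ->
  X `<=` f @` Y -> exists Y0, [/\ finite_set Y0, Y0 `<=` Y & X = f @` Y0].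
Proof.
move=> finX XY; have [[x0 /XY[y0 Yy0 _]]|X0] := pselect (X !=set0); last first.
  exists set0; split=> //; rewrite image_set0 predeqE => x; split=> // Xx.
  by case: X0; exists x.
have /choice[g gP] : forall x, exists y, X x -> Y y /\ f y = x.
  move=> x; have [/XY[y Yy fy]|nX] := pselect (X x); first by exists y.
  by exists y0.
exists (g @` X); split; first exact: finite_image.
  by move=> _ [x /gP[Yg _] <-].
rewrite predeqE => x; split=> [Xx|[_ [x' Xx' <-] <-]].
  by exists (g x); [exists x | exact: (gP x Xx).2].
by rewrite (gP x' Xx').2.
Qed.

End Finiteness.

Section Saturation.
Variables (B : finType) (L : language B).
Implicit Types (G : sequent L) (P S : set (sentence L)) (phi : sentence L).

(** Derivable sequents may be infinite, whereas the limit of a chain of sequents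
    is controlled by its members only through finite subsequents. *)
Definition consistent G := forall P S, finite_set P -> finite_set S ->
  (P ==>s S) `<=` G -> ~ derivable (P ==>s S).

Lemma consistent_sub G G' : G `<=` G' -> consistent G' -> consistent G.
Proof. by move=> GG' cG' P S fP fS /subset_trans/(_ GG'); exact: cG'. Qed.

Lemma sub_mkseq P S G : (P ==>s S) `<=` G <->
  (forall phi, P phi -> G (Lft, phi)) /\ (forall phi, S phi -> G (Rgt, phi)).
Proof.
split=> [sub|[PG SG] [[] phi]]; [|exact: PG|exact: SG].
by split=> phi hphi; exact: sub.
Qed.

Lemma sub_setD1U (T : Type) (X : set T) x : X `<=` (X `\ x) `|` [set x].
Proof.
by move=> y Xy; have [->|yx] := pselect (y = x); [right | left].
Qed.

Lemma inconsistentL G phi : ~ consistent (G `|` [set (Lft, phi)]) ->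
  exists P S, [/\ finite_set P, finite_set S, (P ==>s S) `<=` G
    & derivable (P ,+ phi ==>s S)].
Proof.
move=> nc; apply: contrapT => nex; apply: nc => P S fP fS /sub_mkseq[PG SG] d.
apply: nex; exists (P `\ phi), S; split=> //; first exact: finite_setD.
  apply/sub_mkseq; split=> psi; last by move=> /SG[].
  by move=> [/PG[]// [->] []].
by apply: RuleW d => //; exact: sub_setD1U.
Qed.

Lemma inconsistentR G phi : ~ consistent (G `|` [set (Rgt, phi)]) ->
  exists P S, [/\ finite_set P, finite_set S, (P ==>s S) `<=` G
    & derivable (P ==>s S ,+ phi)].
Proof.
move=> nc; apply: contrapT => nex; apply: nc => P S fP fS /sub_mkseq[PG SG] d.
apply: nex; exists P, (S `\ phi); split=> //; first exact: finite_setD.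
  apply/sub_mkseq; split=> psi; first by move=> /PG[].
  by move=> [/SG[]// [->] []].
by apply: RuleW d => //; exact: sub_setD1U.
Qed.

Definition holds_in G (sd : side) (A : term L formula_ty) : Prop :=
  exists2 phi, G (sd, phi) & form phi = A.

Definition witnessed G (sd : side) t (A : term L t) : Prop :=
  match sd, A with
  | Rgt, Inc s A1 A2 => exists Cs : tup (term L) s,
      [/\ closed_tup Cs, holds_in G Lft (apps A1 Cs)
        & holds_in G Rgt (apps A2 Cs)]
  | _, _ => True
  end.

(** If a sentence of a maximal consistent sequent is the principal formula of a
    rule, then the active formula of some premise is also in the sequent:
    otherwise each premise is derivable from finitely many members, and the rule
    makes the sequent itself inconsistent. Maximality cannot supply the fresh
    constants for an inclusion on the right, hence the last hypothesis. *)
Lemma saturated_hintikka G : consistent G ->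
  (forall p, consistent (G `|` [set p]) -> G p) ->
  (forall p, G p -> witnessed G p.1 (form p.2)) -> hintikka (holds_in G).
Proof.
move=> cG maxG witG; split.
- move=> _ [phi GL <-] [psi GR /sentence_inj e]; subst psi.
  apply: (cG [set phi] [set phi]) => //.
    by apply/sub_mkseq; split=> _ ->.
  rewrite -[X in X ==>s _]set0U -[X in _ ==>s X]set0U; exact: RuleR.
- move=> [[A cA] GL /= e]; subst A.
  apply: (cG [set Sentence cA] set0) => //.
    by apply/sub_mkseq; split=> // _ ->.
  by rewrite -[X in X ==>s _]set0U; exact: RuleBotL.
- move=> sd x s A b Cs cb [[F h] Gp /= e]; subst F.
  have h1 : closed_term (apps (subst x b A) Cs).
    move: (h); rewrite !closed_apps closed_App => /andP[/andP[cA _] ->].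
    by rewrite closed_subst.
  exists (Sentence h1) => //; apply: maxG.
  have ff : free_for x b A by exact: free_for_closed.
  apply: contrapT; case: sd Gp => Gp.
    move=> /inconsistentL[P [S [fP fS /sub_mkseq[PG SG] d]]].
    apply: (cG (P ,+ Sentence h) S) => //; first by rewrite finite_setU.
      by apply/sub_mkseq; split=> // psi [/PG|->].
    exact: RuleLamL d.
  move=> /inconsistentR[P [S [fP fS /sub_mkseq[PG SG] d]]].
  apply: (cG P (S ,+ Sentence h)) => //; first by rewrite finite_setU.
    by apply/sub_mkseq; split=> // psi [/SG|->].
  exact: RuleLamR d.
- move=> s A A' Cs cCs [[F h] Gp /= e]; subst F.
  have [h1 h2] : closed_term (apps A' Cs) /\ closed_term (apps A Cs).
    by move: (h); rewrite closed_Inc !closed_apps cCs => /andP[-> ->].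
  apply: contrapT => /not_orP[nL nR].
  have /inconsistentL[P [S [fP fS /sub_mkseq[PG SG] d]]] :
      ~ consistent (G `|` [set (Lft, Sentence h1)]).
    by move=> /maxG Gh1; apply: nL; exists (Sentence h1).
  have /inconsistentR[P' [S' [fP' fS' /sub_mkseq[PG' SG'] d']]] :
      ~ consistent (G `|` [set (Rgt, Sentence h2)]).
    by move=> /maxG Gh2; apply: nR; exists (Sentence h2).
  apply: (cG ((P `|` P') ,+ Sentence h) (S `|` S')); rewrite ?finite_setU //.
    apply/sub_mkseq; split=> psi; first by case=> [[/PG|/PG']|->].
    by case=> [/SG|/SG'].
  apply: (@RuleIncL _ _ _ _ _ _ _ _ h1 h2).
    by apply: RuleW d; [apply: setSU; left | left].
  by apply: RuleW d'; [right | apply: setSU; right].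
- by move=> s A A' [[F h] /witG + /= e]; subst F.
Qed.

(** Every type has constants outside any finite list that do not occur in the
    sequent; unlike the existence of a single such constant, this property is
    preserved when a sentence is added. *)
Definition roomy G := forall t (l : seq (con L)), exists c : con L,
  [/\ con_ty L c = t, c \notin l
    & forall p, G p -> c \notin consts (form p.2)].

Lemma roomy_add G p : roomy G -> roomy (G `|` [set p]).
Proof.
move=> rG t l; have [c [ct]] := rG t (l ++ consts (form p.2)).
rewrite mem_cat => /norP[cl cp] cG.
by exists c; split=> // q [/cG|->].
Qed.

Lemma roomy_fresh G (s : seq (ty B)) : roomy G ->
  exists cs : seq (con L), map (con_ty L) cs = s /\ fresh cs G.
Proof.
move=> rG; elim: s => [|t s [cs [<- [ucs csG]]]]; first by exists [::].
have [c [<- ccs cG]] := rG t cs; exists (c :: cs); split=> //.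
split=> [|c']; first by rewrite /= ccs.
by rewrite inE => /predU1P[->|/csG].
Qed.

Lemma fresh_sub (cs : seq (con L)) G G' : G `<=` G' -> fresh cs G' -> fresh cs G.
Proof. by move=> GG' [ucs csG]; split=> // c /csG{}csG p /GG'/csG. Qed.

Lemma witnessedT G sd t (A : term L t) :
  (sd = Rgt -> forall s (A1 A2 : term L (Complex s)),
    Tagged (term L) A <> Tagged (term L) (Inc A1 A2)) ->
  witnessed G sd A.
Proof. by case: sd => //; case: A => // s A1 A2 /(_ erefl s A1 A2). Qed.

(** A derivation from the enlarged sequent would become, by the rule for
    inclusions on the right, a derivation from the original one, because the
    constants are fresh for it and the inclusion already belongs to it. *)
Lemma add_witnesses G (cs : seq (con L))
    (A A' : term L (Complex (map (con_ty L) cs))) (h : closed_term (Inc A A'))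
    (h1 : closed_term (apps A (const_tup cs)))
    (h2 : closed_term (apps A' (const_tup cs))) :
  G (Rgt, Sentence h) -> fresh cs G -> consistent G ->
  consistent (G `|` [set (Lft, Sentence h1)] `|` [set (Rgt, Sentence h2)]).
Proof.
move=> Gh frG cG P S fP fS /sub_mkseq[PG SG] d.
have sub : (P `\ Sentence h1 ==>s (S `\ Sentence h2) ,+ Sentence h) `<=` G.
  apply/sub_mkseq; split=> psi.
    by case=> /PG[[//|[->] []]|[]].
  by case=> [[/SG[[//|[]]|[->] []]]|->].
apply: (cG _ _ _ _ sub).
- exact: finite_setD.
- by rewrite finite_setU; split; first exact: finite_setD.
apply: RuleIncR (h1) (h2) _ (fresh_sub sub frG) _.
by apply: RuleW d; exact: sub_setD1U.
Qed.

Lemma add_signed G (p : side * sentence L) : consistent G -> roomy G ->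
  exists G', [/\ G `<=` G', consistent G', roomy G'
    & consistent (G `|` [set p]) -> G' p /\ witnessed G' p.1 (form p.2)].
Proof.
move=> cG rG; have [cGp|ncGp] := pselect (consistent (G `|` [set p])); last first.
  by exists G; split.
have rGp : roomy (G `|` [set p]) by exact: roomy_add.
have [[sd [s [A [A' e]]]]|nInc] := pselect (p.1 = Rgt /\
    exists s (A A' : term L (Complex s)), form p.2 = Inc A A'); last first.
  exists (G `|` [set p]); split=> // _; split; first by right.
  apply: witnessedT => sd s A A' e; apply: nInc.
  by split=> //; exists s, A, A'; exact: eq_from_Tagged e.
case: p sd e cGp rGp => sd [F h] /= -> e; subst F => cGp rGp.
have [cs [es frcs]] := roomy_fresh s rGp; subst s.
have [h1 h2] : closed_term (apps A (const_tup cs)) /\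
    closed_term (apps A' (const_tup cs)).
  by move: (h); rewrite closed_Inc !closed_apps closed_const_tup => /andP[-> ->].
exists (G `|` [set (Rgt, Sentence h)] `|` [set (Lft, Sentence h1)]
  `|` [set (Rgt, Sentence h2)]); split.
- by move=> q Gq; do 3 left.
- by apply: add_witnesses => //; right.
- by do 2 apply: roomy_add.
- split; first by do 2 left; right.
  exists (const_tup cs); split; first exact: closed_const_tup.
    by exists (Sentence h1) => //; left; right.
  by exists (Sentence h2) => //; right.
Qed.

(** Step n treats the sentence with code n. A sentence that is consistent with
    the limit is consistent with the stage at which it is treated, so it has
    been added, with its witnesses. *)
Lemma saturation G : consistent G -> roomy G ->
  exists2 G', G `<=` G' & hintikka (holds_in G').
Proof.
move=> cG rG.
pose good := {X : sequent L | consistent X /\ roomy X}.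
have /choice[next nextP] : forall nX : nat * good, exists Y : good,
    sval nX.2 `<=` sval Y /\ forall p, signed_code p = nX.1 ->
    consistent (sval nX.2 `|` [set p]) ->
    sval Y p /\ witnessed (sval Y) p.1 (form p.2).
  move=> [n [X [cX rX]]] /=.
  have [[p pn]|np] := pselect (exists p : side * sentence L, signed_code p = n).
    have [Y [XY cY rY pY]] := add_signed p cX rX.
    exists (exist _ Y (conj cY rY)); split=> // q; rewrite -pn.
    by move=> /signed_code_inj ->.
  exists (exist _ X (conj cX rX)); split=> // p pn; case: np; by exists p.
pose F := fix F n : good :=
  if n is n'.+1 then next (n', F n') else exist _ G (conj cG rG).
have monF m n : m <= n -> sval (F m) `<=` sval (F n).
  elim: n => [|n IHn]; first by rewrite leqn0 => /eqP->.
  rewrite leq_eqVlt => /predU1P[->//|/IHn Fmn].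
  by apply: (subset_trans Fmn); exact: (nextP (n, F n)).1.
pose M : sequent L := \bigcup_n sval (F n).
have FM n : sval (F n) `<=` M by move=> p Fp; exists n.
have maxM p : consistent (M `|` [set p]) ->
    M p /\ witnessed M p.1 (form p.2).
  move=> cMp; have [_ /(_ p erefl) []] := nextP (signed_code p, F (signed_code p)).
    by apply: consistent_sub cMp; apply: setSU; exact: FM.
  move=> /= Fp wit; have subM := FM (signed_code p).+1.
  split; first exact: subM.
  case: p.1 wit => //; case: (form p.2) => // s A A' [Cs [cCs [a ? ?] [b ? ?]]].
  by exists Cs; split=> //; [exists a | exists b] => //; exact: subM.
have cM : consistent M.
  move=> P S fP fS /sub_mkseq[PM SM].
  have [n Pn] := finite_sub_chain (F := fun n => [set phi | sval (F n) (Lft, phi)])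
    fP (fun m n mn phi => monF m n mn (Lft, phi))
    (fun phi Pphi => let: ex_intro2 n _ Fn := PM phi Pphi in ex_intro _ n Fn).
  have [m Sm] := finite_sub_chain (F := fun n => [set phi | sval (F n) (Rgt, phi)])
    fS (fun m n mn phi => monF m n mn (Rgt, phi))
    (fun phi Sphi => let: ex_intro2 n _ Fn := SM phi Sphi in ex_intro _ n Fn).
  apply: (proj1 (svalP (F (maxn n m)))) => //; apply/sub_mkseq.
  by split=> [phi /Pn|phi /Sm]; apply: monF; [exact: leq_maxl | exact: leq_maxr].
exists M; first exact: (FM 0).
apply: saturated_hintikka => // [p /maxM[]//|p Mp].
by apply: (maxM p _).2; apply: consistent_sub cM => q [|->].
Qed.

End Saturation.

(** * Additional constants *)

Section Extension.
Variables (B : finType) (L C : language B).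
Local Notation LC := (lang_union L C).

Lemma consts_emb t (A : term L t) (c : con C) :
  (inr c : con LC) \notin consts (emb C A).
Proof.
by elim: A => //= [? ? ? IHA ? IHb|? ? IHA ? IHb]; rewrite mem_cat negb_or IHA.
Qed.

Lemma emb_subst (x : var B) (b : term L x.1) t (A : term L t) :
  emb C (subst x b A) = subst x (emb C b) (emb C A).
Proof.
elim: A => //= [y|? ? ? -> ? ->|y ? A IHA|? ? -> ? ->] //; last first.
  by case: eqP => // _; rewrite IHA.
have [e|yx] := eqVneq y x; last by rewrite !dfwith_out // eq_sym.
by subst y; rewrite !dfwith_in.
Qed.

Lemma emb_free_for (x : var B) (b : term L x.1) t (A : term L t) :
  free_for x (emb C b) (emb C A) = free_for x b A.
Proof.
elim: A => //= [? ? ? -> ? ->|y ? ? ->|? ? -> ? ->] //.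
by rewrite !fv_emb.
Qed.

Definition reduct (M : intensional_model LC) : intensional_model L.
Proof.
apply: (@IntensionalModel B L (dom M) (@dom_inhabited _ _ M)
  (fun a t A => intn a (emb C A)) _ (@extn _ _ M)).
- have [Ivar Ifv Isub] := intnP M; split=> [a x|a a' t A aa'|a x b t A ff].
  + exact: Ivar.
  + by apply: Ifv => x; rewrite fv_emb; exact: aa'.
  + by rewrite emb_subst Isub // emb_free_for.
- by move=> a; exact: extn_bot.
- by move=> a t s A b; exact: extn_app.
- by move=> a x s A; exact: extn_lam.
- by move=> a s A A'; exact: extn_inc.
Defined.

Definition emb_signed (p : side * sentence L) : side * sentence LC :=
  (p.1, emb_sentence C p.2).

Lemma unprovable_consistent (G : sequent L) :
  ~ provable C G -> consistent (emb_signed @` G).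
Proof.
move=> nG P S fP fS /sub_mkseq[PG SG] d; apply: nG.
have [P0 [fP0 P0G eP]] : exists P0, [/\ finite_set P0,
    P0 `<=` [set phi | G (Lft, phi)] & P = emb_sentence C @` P0].
  apply: finite_sub_image => // _ /PG[[sd phi] Gp [/= e <-]].
  by exists phi => //; rewrite -e.
have [S0 [fS0 S0G eS]] : exists S0, [/\ finite_set S0,
    S0 `<=` [set phi | G (Rgt, phi)] & S = emb_sentence C @` S0].
  apply: finite_sub_image => // _ /SG[[sd phi] Gp [/= e <-]].
  by exists phi => //; rewrite -e.
exists P0, S0; split=> //; last by rewrite -eP -eS.
by apply/sub_mkseq; split=> phi; [exact: P0G | exact: S0G].
Qed.

Hypothesis C_denumerable : forall t : ty B,
  ([set c : con C | con_ty C c = t] #= [set: nat])%card.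

Lemma denumerable_roomy (G : sequent L) : roomy (emb_signed @` G).
Proof.
move=> t l; apply: contrapT => nex.
have : finite_set [set c : con C | con_ty C c = t].
  apply: (@sub_finite_set _ _
    [set` pmap (fun c : con LC => if c is inr c' then Some c' else None) l]).
    move=> c /= ct; rewrite mem_pmap; apply: contrapT => cl; apply: nex.
    exists (inr c : con LC); split=> //.
      by apply: contra_notN cl => cl; apply/mapP; exists (inr c).
    by move=> _ [p _ <-]; exact: consts_emb.
  by apply/finite_seqP; eexists.
rewrite (eq_finite_set (C_denumerable t)) => fin; exact: infinite_nat fin.
Qed.

Lemma closed_term_exists (t : ty B) : exists A : term LC t, closed_term A.
Proof.
by have [c [<- _ _]] := denumerable_roomy set0 t [::]; exists (Const c).
Qed.

Lemma unprovable_refuted (G : sequent L) :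
  ~ provable C G -> exists M : intensional_model L, refutes M G.
Proof.
move=> /unprovable_consistent cG.
have [G' GG' hG'] := saturation cG (denumerable_roomy G).
pose M := @hintikka_model _ _ _ hG' (fun t => sval (cid (closed_term_exists t)))
  (fun t => svalP (cid (closed_term_exists t))).
exists (reduct M); split=> phi Gphi.
  apply: (hintikka_modelP hG' _ (emb_sentence C phi)).1.
  by exists (emb_sentence C phi) => //; apply: GG'; exists (Lft, phi).
apply: (hintikka_modelP hG' _ (emb_sentence C phi)).2.
by exists (emb_sentence C phi) => //; apply: GG'; exists (Rgt, phi).
Qed.

End Extension.

Theorem corollary9 (B : finType) (L C : language B)
    (C_denumerable : forall t : ty B,
      ([set c : con C | con_ty C c = t] #= [set: nat])%card) :
  (forall G : sequent L, i_valid G -> provable C G) /\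
  (forall Pi Sigma : set (sentence L),
     i_entails Pi Sigma -> entails C Pi Sigma).
Proof.
have complete (G : sequent L) : i_valid G -> provable C G.
  move=> validG; apply: contrapT => nG; apply: validG.
  exact: unprovable_refuted nG.
by split=> // Pi Sigma; exact: complete.
Qed.
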